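(* Let $G_{64}$ be the explicit graph on $\mathbb{Z}_{64}$ defined in the context. Then $G_{64}$ is $4$-connected, and indeed $\kappa(G_{64})=\lambda(G_{64})=\delta(G_{64})=4$; it has $64$ vertices and $152$ edges, with $48$ vertices of degree $5$ and $16$ vertices of degree $4$. Moreover: (i) $G_{64}$ contains no cycle of length $3$, $4$ or $5$, and contains the $6$-cycle $(0,40,36,44,34,15)$; hence its girth is exactly $6$. (ii) The map $c:\mathbb{Z}_{64}\to\{0,1,2,3\}$ listed in the context is a proper $4$-colouring of $G_{64}$, and $G_{64}$ admits no proper $3$-colouring; hence $\chi(G_{64})=4$. (iii) $G_{64}$ is vertex-critical and edge-critical: for every vertex $v$ the graph $G_{64}-v$ is $3$-colourable, and for every edge $e$ the graph $G_{64}-e$ is $3$-colourable. (iv) The independence number of $G_{64}$ is $24$. (v) $\operatorname{Aut}(G_{64})$ is cyclic of order $8$, generated by the semiregular automorphism $v\mapsto v+8 \bmod 64$; consequently $\operatorname{Aut}(G_{64})$ has $8$ orbits on vertices and $20$ orbits on edges.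
   Context: Definition of $G_{64}$: it is the simple undirected graph with vertex set $\mathbb{Z}_{64}=\{0,\dots,63\}$ whose edge set is the union of the orbits, under the map $v\mapsto v+8 \pmod{64}$, of the $20$ edges $\{i,\,i+t \bmod 64\}$ for the pairs $(i,t)$ in the list $(0,15)$, $(0,24)$, $(0,49)$, $(0,60)$, $(1,5)$, $(1,22)$, $(1,38)$, $(1,42)$, $(2,10)$, $(2,32)$, $(2,45)$, $(2,52)$, $(3,17)$, $(3,32)$, $(3,42)$, $(4,8)$, $(5,1)$, $(5,41)$, $(5,42)$, $(5,57)$. Explicitly, the orbit of the pair $(i,t)$ consists of the edges $\{v,\,v+t \bmod 64\}$ with $v\equiv i \pmod 8$. The colouring $c=(c(0),c(1),\dots,c(63))$ is: $c(0),\dots,c(23) = 0,0,0,0,0,0,2,0,3,0,0,0,3,0,3,3,2,1,0,0,2,1,0,2$; $c(24),\dots,c(47) = 3,2,1,2,1,1,0,3,0,1,2,2,2,1,0,2,3,1,3,2,0,3,2,3$; $c(48),\dots,c(63) = 2,3,1,3,1,1,2,2,3,0,3,0,3,1,2,3$. Here $\kappa$, $\lambda$, $\delta$, $\chi$ denote vertex-connectivity, edge-connectivity, minimum degree and chromatic number. An automorphism is semiregular if all its cycles on the vertex set have the same length, i.e. no non-identity element of the cyclic group it generates fixes a vertex. *)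

(* Defs.v *)
From HB Require Import structures.
From mathcomp Require Import all_boot all_order all_algebra all_fingroup.
From mathcomp Require Import all_solvable.

Set Implicit Arguments.
Unset Strict Implicit.
Unset Printing Implicit Defensive.

Import GRing.Theory.

Record sgraph := SGraph {
  vertex :> finType;
  adj : rel vertex;
  adj_sym : symmetric adj;
  adj_irrefl : irreflexive adj }.
Arguments adj : clear implicits.

Definition edges (G : sgraph) : {set {set G}} :=
  [set [set p.1; p.2] | p : G * G & adj G p.1 p.2].

Definition degree (G : sgraph) (v : G) : nat := #|[set w | adj G v w]|.

(* The default value #|G| exceeds every degree, so it only matters for the
   graph without vertices. *)
Definition min_degree (G : sgraph) : nat :=
  \big[minn/#|G|]_(v : G) degree v.

Section Subgraphs.
Variable G : sgraph.

Definition induced_adj (S : {set G}) : rel {x : G | x \in S} :=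
  fun x y => adj G (val x) (val y).

Fact induced_adj_sym S : symmetric (@induced_adj S).
Proof. by move=> x y; apply: adj_sym. Qed.

Fact induced_adj_irrefl S : irreflexive (@induced_adj S).
Proof. by move=> x; apply: adj_irrefl. Qed.

Definition induced (S : {set G}) : sgraph :=
  SGraph (@induced_adj_sym S) (@induced_adj_irrefl S).

Definition del_vertices (X : {set G}) : sgraph := induced (~: X).

Definition del_edges_adj (F : {set {set G}}) : rel G :=
  fun x y => adj G x y && ([set x; y] \notin F).

Fact del_edges_adj_sym F : symmetric (del_edges_adj F).
Proof. by move=> x y; rewrite /del_edges_adj adj_sym setUC. Qed.

Fact del_edges_adj_irrefl F : irreflexive (del_edges_adj F).
Proof. by move=> x; rewrite /del_edges_adj adj_irrefl. Qed.

Definition del_edges (F : {set {set G}}) : sgraph :=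
  SGraph (del_edges_adj_sym F) (del_edges_adj_irrefl F).

End Subgraphs.

Definition connected (G : sgraph) : bool :=
  (0 < #|G|) && [forall x : G, forall y : G, connect (adj G) x y].

Definition k_connected (G : sgraph) (k : nat) : bool :=
  (k < #|G|) &&
  [forall X : {set G}, (#|X| < k) ==> connected (del_vertices X)].

Definition k_edge_connected (G : sgraph) (k : nat) : bool :=
  (1 < #|G|) &&
  [forall F : {set {set G}},
     (F \subset edges G) && (#|F| < k) ==> connected (del_edges F)].

(* The largest k such that G is k-connected; k < #|G| always holds then. *)
Definition vertex_connectivity (G : sgraph) : nat :=
  \max_(k < #|G| | k_connected G k) k.

(* The largest k such that G is k-edge-connected; removing all the edges
   disconnects a graph on at least two vertices, so k <= #|edges G|. *)
Definition edge_connectivity (G : sgraph) : nat :=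
  \max_(k < #|edges G|.+1 | k_edge_connected G k) k.

(* s lists the vertices of the cycle once each, in cyclic order. *)
Definition is_cycle (G : sgraph) (s : seq G) : bool :=
  [&& 2 < size s, uniq s & path.cycle (adj G) s].

Definition has_cycle (G : sgraph) (n : nat) : bool :=
  [exists s : n.-tuple G, is_cycle s].

(* None if G is acyclic. *)
Definition girth (G : sgraph) : option nat :=
  omap val [pick n : 'I_(#|G|.+1) | has_cycle G n &&
    [forall m : 'I_(#|G|.+1), has_cycle G m ==> (n <= m)]].

Definition proper_coloring (G : sgraph) (k : nat) (f : G -> 'I_k) : bool :=
  [forall x, forall y, adj G x y ==> (f x != f y)].

Definition colorable (G : sgraph) (k : nat) : bool :=
  [exists f : {ffun G -> 'I_k}, proper_coloring f].

Fact ex_colorable (G : sgraph) : exists k, colorable G k.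
Proof.
exists #|G|; apply/existsP; exists [ffun x => enum_rank x].
apply/forallP=> x; apply/forallP=> y; apply/implyP=> xy.
rewrite !ffunE (inj_eq enum_rank_inj); apply: contraTneq xy => ->.
by rewrite adj_irrefl.
Qed.

Definition chromatic_number (G : sgraph) : nat := ex_minn (ex_colorable G).

Definition vertex_critical (G : sgraph) : Prop :=
  forall v : G,
    chromatic_number (del_vertices [set v]) < chromatic_number G.

Definition edge_critical (G : sgraph) : Prop :=
  forall e, e \in edges G ->
    chromatic_number (del_edges [set e]) < chromatic_number G.

Definition independent (G : sgraph) (S : {set G}) : bool :=
  [forall x in S, forall y in S, ~~ adj G x y].

Definition independence_number (G : sgraph) : nat :=
  \max_(S : {set G} | independent S) #|S|.

Section Automorphisms.
Variable G : sgraph.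

Definition graph_aut : {set {perm G}} :=
  [set s : {perm G} | [forall x, forall y, adj G (s x) (s y) == adj G x y]].

Fact graph_aut_group_set : group_set graph_aut.
Proof.
apply/group_setP; split=> [|s t].
  by rewrite inE; apply/forallP=> x; apply/forallP=> y; rewrite !perm1.
rewrite !inE => /forallP sG /forallP tG.
apply/forallP=> x; apply/forallP=> y; rewrite !permM.
by rewrite (eqP (forallP (tG _) _)) (eqP (forallP (sG _) _)).
Qed.

Canonical graph_aut_group := Group graph_aut_group_set.

(* The orbits are those of the natural action of permutations on vertices,
   and of the induced action on sets of vertices. *)
Definition vertex_orbits : {set {set G}} :=
  orbit 'P graph_aut @: [set: G].

Definition edge_orbits : {set {set {set G}}} :=
  orbit ('P^*)%act graph_aut @: edges G.

End Automorphisms.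

Definition semiregular_perm (T : finType) (s : {perm T}) : Prop :=
  forall x y : T, #|porbit s x| = #|porbit s y|.

(* The pair (i, t) stands for the edges {v, v + t} with v = i modulo 8, i.e. the
   orbit of {i, i + t} under v |-> v + 8. *)
Definition G64_pairs : seq (nat * nat) :=
  [:: (0,15); (0,24); (0,49); (0,60); (1,5); (1,22); (1,38); (1,42);
      (2,10); (2,32); (2,45); (2,52); (3,17); (3,32); (3,42); (4,8);
      (5,1); (5,41); (5,42); (5,57)].

Definition G64_arc (u v : 'Z_64) : bool :=
  has (fun p => (u == p.1 %[mod 8]) && (v == u + p.2%:R)%R) G64_pairs.

Definition G64_adj : rel 'Z_64 := fun u v => G64_arc u v || G64_arc v u.

Fact G64_adj_sym : symmetric G64_adj.
Proof. by move=> u v; rewrite /G64_adj orbC. Qed.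

Fact G64_adj_irrefl : irreflexive G64_adj.
Proof.
move=> u; rewrite /G64_adj orbb; apply/negbTE/hasPn=> p pP.
have /allP/(_ p pP) p2 : all (fun p => p.2 %% 64 != 0) G64_pairs by [].
rewrite negb_and; apply/orP; right; apply: contraNneq p2 => /eqP.
rewrite -subr_eq0 opprD addrA subrr sub0r oppr_eq0 => /eqP/(congr1 val).
by rewrite /= val_Zp_nat // => ->.
Qed.

Definition G64 : sgraph := SGraph G64_adj_sym G64_adj_irrefl.

Definition c64_values : seq nat :=
  [:: 0;0;0;0;0;0;2;0;3;0;0;0;3;0;3;3;2;1;0;0;2;1;0;2;
      3;2;1;2;1;1;0;3;0;1;2;2;2;1;0;2;3;1;3;2;0;3;2;3;
      2;3;1;3;1;1;2;2;3;0;3;0;3;1;2;3].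

Definition c64 (v : G64) : 'I_4 := inord (nth 0 c64_values v).

(* v |-> v + 8 *)
Definition rot8 : {perm G64} := perm (@addIr 'Z_64 8%R).

(* Main.v *)
Require Import Defs.
From HB Require Import structures.
From mathcomp Require Import all_boot all_order all_algebra all_fingroup.
From mathcomp Require Import all_solvable.

(** The graph has 64 vertices and a semiregular rotation v |-> v + 8, so each
    claim splits into a general fact about graphs and a finite check that is
    small once the fact is chosen well; the checks are made by programs on
    natural numbers, each with its soundness lemma, and [adjE] carries them to
    the graph.

    Connectivity.  [k_connected_hub] reduces 4-connectedness to families of
    four disjoint paths: from every vertex to the orbit of 0, and between any
    two vertices of that orbit.  Up to rotation these are 7 + 7 families.  The
    inequalities of Whitney, kappa <= lambda <= delta ([k_connected_edge],
    [k_edge_connected_degree]), and a vertex of degree 4 then give all three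
    parameters.  The number of edges comes from the degrees by [handshake].

    Girth.  From each arc xy, no path with at most three more vertices returns
    to a neighbour of x ([no_short_cycle]).

    Chromatic number.  With the colours of two adjacent vertices fixed, an
    exhaustive search that always colours a most constrained vertex
    ([refutesP]) finds no 3-colouring.  For criticality it is enough to give a
    3-colouring of G64 - e for one edge e of each of the 20 orbits: rotation
    moves it to the other edges, and G64 - v is a subgraph of G64 - e for every
    edge e at v.

    Independence number.  The upper bound is a branch and bound search
    ([branching_boundP]): a greedy matching covers the remaining vertices by
    edges and single vertices, and an independent set takes at most one vertex
    from each.

    Automorphisms.  After a rotation, an automorphism sends 6 to one of
    0, ..., 7.  Extending such a partial map vertex by vertex, always next to a
    vertex already mapped, leaves only the identity ([rigidP]), so that the
    rotation generates the group.  Its vertex orbits all have 8 elements, and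
    the 20 base edges represent the edge orbits. *)

Set Implicit Arguments.
Unset Strict Implicit.
Unset Printing Implicit Defensive.

Import GRing.Theory.

(** * Connectivity, girth, chromatic number and automorphisms of graphs *)

Section GraphTheory.
Variable G : sgraph.
Implicit Types (u v w x y : G) (X : {set G}) (F : {set {set G}}).

Lemma edge_in_edges u v : adj G u v -> [set u; v] \in edges G.
Proof. by move=> uv; apply/imsetP; exists (u, v); rewrite ?inE. Qed.

Lemma edgesP e :
  reflect (exists u v, adj G u v /\ e = [set u; v]) (e \in edges G).
Proof.
apply: (iffP imsetP) => [[[u v]]|[u [v [uv ->]]]].
  by rewrite inE => uv ->; exists u, v.
by exists (u, v); rewrite ?inE.
Qed.

Lemma eq_set2 u v x y :
  ([set u; v] == [set x; y]) = (u == x) && (v == y) || (u == y) && (v == x).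
Proof.
apply/eqP/idP => [E|/orP[]/andP[/eqP-> /eqP->] //]; last exact: setUC.
have : u \in [set x; y] by rewrite -E set21.
have : v \in [set x; y] by rewrite -E set22.
have : x \in [set u; v] by rewrite E set21.
have : y \in [set u; v] by rewrite E set22.
rewrite !in_set2 ![_ == u]eq_sym ![_ == v]eq_sym.
by do 4 case: eqP => //=.
Qed.

Lemma adj_neq u v : adj G u v -> u != v.
Proof. by apply: contraTneq => ->; rewrite adj_irrefl. Qed.

Lemma card_lt_exists X : #|X| < #|G| -> exists v, v \notin X.
Proof.
move=> lt; have : 0 < #|~: X| by rewrite -(ltn_add2l #|X|) addn0 cardsC.
by case/card_gt0P=> v; rewrite inE; exists v.
Qed.

(** A walk of G that avoids X is a walk of G - X; the lemma moves it into the
    subtype on which G - X lives. *)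
Lemma connect_del_vertices X (x y : del_vertices X) (p : seq G) :
    path (adj G) (val x) p -> last (val x) p = val y ->
    {in p, forall z, z \notin X} ->
  connect (adj (del_vertices X)) x y.
Proof.
elim: p x => [|z p IH] x /=; first by move=> _ /val_inj->.
case/andP=> xz zp lst out.
have zX : z \in ~: X by rewrite inE out ?mem_head.
apply: (connect_trans (connect1 _) (IH (Sub z zX) zp lst _)) => //.
by move=> t tp; rewrite out // in_cons tp orbT.
Qed.

(** Deleting the neighbours of v isolates v, and a vertex other than v is left
    because k < #|G|. *)
Lemma k_connected_degree k v : k_connected G k -> k <= degree v.
Proof.
case/andP=> kG /forallP kc; rewrite leqNgt; apply/negP=> dv.
pose X := [set w | adj G v w].
have [w] : exists w, w \notin v |: X.
  apply: card_lt_exists; apply: leq_ltn_trans kG.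
  by rewrite cardsU1; apply: leq_trans dv; rewrite -add1n leq_add2r leq_b1.
rewrite in_setU1 negb_or => /andP[wv wX].
have vX : v \in ~: X by rewrite !inE adj_irrefl.
have {}wX : w \in ~: X by rewrite inE.
have /andP[_] := implyP (kc X) dv.
move/forallP/(_ (Sub v vX))/forallP/(_ (Sub w wX))/connectP=> [[|a p] /=].
  by move=> _ /(congr1 val) /= E; rewrite E eqxx in wv.
rewrite /induced_adj /= => /andP[va _] _.
by have := valP a; rewrite !inE va.
Qed.

Lemma k_edge_connected_degree k v : k_edge_connected G k -> k <= degree v.
Proof.
case/andP=> G1 /forallP kc; rewrite leqNgt; apply/negP=> dv.
pose F := [set [set v; w] | w in [set w | adj G v w]].
have /(implyP (kc F))/andP[_ /forallP/(_ v)/forallP cv] :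
    (F \subset edges G) && (#|F| < k).
  rewrite (leq_ltn_trans (leq_imset_card _ _) dv) andbT.
  by apply/subsetP=> e /imsetP[w]; rewrite inE => vw ->; apply: edge_in_edges.
have [w] : exists w, w \notin [set v] by apply: card_lt_exists; rewrite cards1.
rewrite inE => wv; have /connectP[[|a p] /=] := cv w.
  by move=> _ E; rewrite E eqxx in wv.
rewrite /del_edges_adj => /andP[/andP[va /negP vaF] _] _.
by case: vaF; apply: imset_f; rewrite inE.
Qed.

(** Whitney's inequality. To connect x and y in G - F, delete from every edge of
    F other than xy an end outside {x, y}: a walk that avoids these vertices
    uses no edge of F except possibly xy. If xy itself is in F, one vertex fewer
    was deleted, so x may be deleted too, once a step to a surviving neighbour z
    has been made; the degree of x leaves room for such a z. *)
Lemma k_connected_edge k : 0 < k -> k_connected G k -> k_edge_connected G k.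
Proof.
move=> k0 kG; have := kG; case/andP=> ltkG /forallP kc.
rewrite /k_edge_connected (leq_ltn_trans k0 ltkG) /=.
apply/forallP=> F; apply/implyP=> /andP[FE Fk].
rewrite /connected (leq_ltn_trans _ ltkG) //=.
apply/forallP=> x; apply/forallP=> y.
case: (eqVneq x y) => [->|xy]; first exact: connect0.
pose other (e : {set G}) := odflt x [pick z in e :\: [set x; y]].
(* An edge of F other than xy has an end outside {x, y}, and other picks one. *)
pose X := other @: (F :\ [set x; y]).
have otherP e : e \in edges G -> e != [set x; y] ->
    other e \in e :\: [set x; y].
  case/edgesP=> u [v [uv ->]] ne; rewrite /other; case: pickP => //= none.
  move: (none u) (none v); rewrite !inE !eqxx orbT /= !andbT.
  move/negbFE=> /orP[]/eqP ux /negbFE/orP[]/eqP vx;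
    move: uv ne; rewrite ux vx ?adj_irrefl ?eqxx //.
  by rewrite setUC eqxx.
have notX u : u \in [set x; y] -> u \notin X.
  move=> uxy; apply/imsetP=> -[e]; rewrite in_setD1 => /andP[ne eF] E.
  by have := otherP e (subsetP FE e eF) ne; rewrite -E inE uxy.
have lift_path (Y : {set G}) u v : X \subset Y ->
    (([set x; y] \in F) -> x \in Y) ->
    u \notin Y -> v \notin Y -> #|Y| < k -> connect (adj (del_edges F)) u v.
  move=> XY xyF uY vY Yk; have /andP[_] := implyP (kc Y) Yk.
  have {}uY : u \in ~: Y by rewrite inE.
  have {}vY : v \in ~: Y by rewrite inE.
  move/forallP/(_ (Sub u uY))/forallP/(_ (Sub v vY))/connectP=> -[p pp lp].
  have outY (s : del_vertices Y) : val s \notin Y.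
    by have := valP s; rewrite inE.
  suff avoidF (s : del_vertices Y) : path (adj (del_vertices Y)) s p ->
      connect (adj (del_edges F)) (val s) (val (last s p)).
    by have := avoidF _ pp; rewrite -lp.
  elim: p s {pp lp} => [|a p IH] s //= /andP[sa ap].
  apply: connect_trans (IH _ ap); apply: connect1.
  have {}sa : adj G (val s) (val a) := sa.
  rewrite /= /del_edges_adj sa; apply/negP=> eF.
  have [e_xy|ne] := eqVneq [set val s; val a] [set x; y].
    have : x \in [set val s; val a] by rewrite e_xy set21.
    rewrite e_xy in eF; have xY := xyF eF.
    by case/set2P=> E; move: xY; rewrite E; apply/negP/outY.
  have /setDP[] := otherP _ (subsetP FE _ eF) ne.
  have : other [set val s; val a] \in Y.
    by apply: (subsetP XY); apply: imset_f; rewrite in_setD1 ne.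
  by move=> oY /set2P[] E _; move: oY; rewrite E; apply/negP/outY.
have [xyF|xyF] := boolP ([set x; y] \in F); last first.
  apply: (@lift_path X) => //; rewrite ?notX ?set21 ?set22 ?(negbTE xyF) //.
  apply: leq_ltn_trans Fk; apply: leq_trans (leq_imset_card _ _) _.
  exact: subset_leq_card (subsetDl _ _).
have Xk : #|X|.+2 <= k.
  apply: leq_trans Fk; rewrite (cardsD1 [set x; y]) xyF add1n !ltnS.
  exact: leq_imset_card.
have [z] : exists z, z \in [set w | adj G x w] :\: (y |: X).
  pose N := [set w | adj G x w]; rewrite -/N.
  apply/set0Pn; rewrite -card_gt0 -(ltn_add2l #|N :&: (y |: X)|).
  rewrite addn0 cardsID; apply: leq_trans (k_connected_degree x kG).
  apply: leq_trans Xk; rewrite ltnS.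
  apply: leq_trans (subset_leq_card (subsetIr _ _)) _.
  by rewrite cardsU1 -add1n leq_add2r leq_b1.
rewrite !inE negb_or => /andP[/andP[zy zX] xz].
have zx : z != x by rewrite eq_sym adj_neq.
apply: (@connect_trans _ _ z).
  apply: connect1; rewrite /= /del_edges_adj xz; apply/negP=> eF.
  have ne : [set x; z] != [set x; y].
    by rewrite eq_set2 eqxx (negbTE zy) (negbTE zx) !andbF.
  have := otherP _ (subsetP FE _ eF) ne.
  rewrite !inE negb_or -andbA => /and3P[ox _ /orP[/eqP E|/eqP E]].
    by rewrite E eqxx in ox.
  by case/negP: zX; rewrite -E; apply: imset_f; rewrite in_setD1 ne.
have yX := notX y (set22 x y).
apply: (@lift_path (x |: X)) => //; rewrite ?subsetUr ?setU11 //.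
- by rewrite in_setU1 negb_or zx.
- by rewrite in_setU1 negb_or eq_sym xy.
- by apply: leq_trans Xk; rewrite cardsU1 !ltnS -add1n leq_add2r leq_b1.
Qed.

Lemma vertex_connectivityE k v :
  k_connected G k -> degree v = k -> vertex_connectivity G = k.
Proof.
move=> kc dv; have /andP[kG _] := kc; apply/eqP; rewrite eqn_leq.
apply/andP; split; last exact: (bigmax_sup (Ordinal kG)).
by apply/bigmax_leqP=> i /(k_connected_degree v); rewrite dv.
Qed.

Lemma degree_leq_edges v : degree v <= #|edges G|.
Proof.
have <- : #|[set [set v; w] | w in [set w | adj G v w]]| = degree v.
  apply: card_in_imset => w1 w2; rewrite !inE => vw1 vw2 /eqP.
  by rewrite eq_set2 eqxx /= => /orP[/eqP|/andP[/eqP-> /eqP]].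
by apply/subset_leq_card/subsetP=> e /imsetP[w]; rewrite inE => vw ->;
   apply: edge_in_edges.
Qed.

Lemma edge_connectivityE k v :
  k_edge_connected G k -> degree v = k -> edge_connectivity G = k.
Proof.
move=> kc dv; apply/eqP; rewrite eqn_leq; apply/andP; split.
  by apply/bigmax_leqP=> i /(k_edge_connected_degree v); rewrite dv.
have kE : k < #|edges G|.+1 by rewrite ltnS -dv degree_leq_edges.
exact: (bigmax_sup (Ordinal kE)).
Qed.

Lemma min_degreeE k v :
  (forall w, k <= degree w) -> degree v = k -> min_degree G = k.
Proof.
move=> lb dv; apply/eqP; rewrite eqn_leq; apply/andP; split; last first.
  rewrite /min_degree; elim/big_ind: _ => [|a b ka kb|w _].
  - by rewrite -dv max_card.
  - by rewrite leq_min ka.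
  - exact: lb.
rewrite /min_degree -dv; have := mem_index_enum v.
elim: (index_enum G) => // w s IH; rewrite in_cons big_cons.
case/orP=> [/eqP->|/IH vs]; first exact: geq_minl.
exact: leq_trans (geq_minr _ _) vs.
Qed.

(** The ordered pairs of adjacent vertices are counted by their first entry and
    by their underlying edge, which has two orientations. *)
Lemma handshake : \sum_(v : G) degree v = 2 * #|edges G|.
Proof.
transitivity #|[set p : G * G | adj G p.1 p.2]|.
  rewrite -sum1_card (eq_bigl (fun p : G * G => xpredT p.1 && adj G p.1 p.2)).
    rewrite -(pair_big_dep xpredT (adj G) (fun _ _ => 1)) /=.
    apply: eq_bigr => v _; rewrite sum1_card /degree.
    by apply: eq_card => w; rewrite inE.
  by move=> p; rewrite inE.
rewrite mulnC -[RHS]sum_nat_const.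
rewrite -sum1_card /edges.
rewrite (partition_big_imset (fun p : G * G => [set p.1; p.2])) /=.
apply: eq_bigr => e /edgesP[u [v [uv ->]]]; rewrite sum1_card.
have -> : 2 = #|[set (u, v); (v, u)]|.
  by rewrite cards2 xpair_eqE (negbTE (adj_neq uv)).
apply: eq_card => -[x y]; rewrite !inE /= unfold_in /= inE eq_set2 !xpair_eqE.
by apply: andb_idl => /orP[]/andP[/eqP-> /eqP->] //; rewrite adj_sym.
Qed.

Lemma girthE g : has_cycle G g -> (forall m, has_cycle G m -> g <= m) ->
  girth G = Some g.
Proof.
move=> hg ming; have gG : g < #|G|.+1.
  case/existsP: hg => s /and3P[_ us _]; rewrite ltnS -(size_tuple s).
  by rewrite -(card_uniqP us) max_card.
rewrite /girth; case: pickP => [n /andP[hn /forallP nmin]|/(_ (Ordinal gG))] /=.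
  congr Some; apply/eqP; rewrite eqn_leq ming // andbT.
  exact: (implyP (nmin (Ordinal gG)) hg).
rewrite hg /= => /forallP[] m; apply/implyP; exact: ming.
Qed.

Lemma chromatic_number_leq k : (chromatic_number G <= k) = colorable G k.
Proof.
rewrite /chromatic_number; case: ex_minnP => m /existsP[f /forallP fP] m_min.
apply/idP/idP => [mk|]; last exact: m_min.
apply/existsP; exists [ffun v => widen_ord mk (f v)].
apply/forallP=> x; apply/forallP=> y; apply/implyP=> xy; rewrite !ffunE.
apply: contraNneq (implyP (forallP (fP x) y) xy) => E.
by apply/eqP/val_inj; have /= := congr1 val E.
Qed.

(** Every edge at u disappears with u, the edge uv among them. *)
Lemma colorable_del_vertex u v k : adj G u v ->
  colorable (del_edges [set [set u; v]]) k ->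
  colorable (del_vertices [set u]) k.
Proof.
move=> uv /existsP[f /forallP fP].
apply/existsP; exists [ffun x : del_vertices [set u] => f (val x)].
apply/forallP=> x; apply/forallP=> y; apply/implyP=> xy; rewrite !ffunE.
apply: (implyP (forallP (fP _) _)); rewrite /= /del_edges_adj.
have -> /= : adj G (val x) (val y) := xy.
have := valP x; have := valP y; rewrite !inE => yu xu.
by rewrite eq_set2 (negbTE xu) (negbTE yu) andbF.
Qed.

Lemma graph_autP (s : {perm G}) : s \in graph_aut G ->
  forall u v, adj G (s u) (s v) = adj G u v.
Proof.
by rewrite inE => /forallP sP u v; apply/eqP; apply: (forallP (sP u)).
Qed.

Lemma degree_aut (s : {perm G}) v : s \in graph_aut G ->
  degree (s v) = degree v.
Proof.
move=> /graph_autP sP; rewrite /degree -[RHS](card_imset _ (@perm_inj _ s)).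
apply: eq_card => w; rewrite inE -{1}(permKV s w) sP.
by rewrite -{2}(permKV s w) (mem_imset _ _ (@perm_inj _ s)) inE.
Qed.

(** The colouring is transported along the automorphism, so one edge of each
    orbit is enough. *)
Lemma colorable_del_edge_aut (s : {perm G}) u v k :
  s \in graph_aut G ->
  colorable (del_edges [set [set u; v]]) k ->
  colorable (del_edges [set [set s u; s v]]) k.
Proof.
move=> /graph_autP sP /existsP[f /forallP fP].
apply/existsP; exists [ffun x => f (s^-1%g x)].
apply/forallP=> x; apply/forallP=> y; apply/implyP=> /andP[xy ne].
rewrite !ffunE; apply: (implyP (forallP (fP _) _)).
rewrite /= /del_edges_adj -sP !permKV xy /=.
apply: contra ne; rewrite !inE !eq_set2.
by rewrite !(can2_eq (permKV s) (permK s)).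
Qed.

(** A set X of fewer than k vertices misses one of any k pairwise disjoint
    vertex lists. So if every vertex outside the hub H has k paths into H that
    share only their origin, it keeps a path to H in G - X; and if any two
    vertices of H are joined by k internally disjoint paths, the surviving part
    of H stays connected. *)
Lemma k_connected_hub (H : pred G) k : k < #|G| ->
    (forall u, ~~ H u -> exists ps : seq (seq G),
      [/\ size ps = k, uniq (flatten ps) &
          {in ps, forall p, path (adj G) u p /\ H (last u p)}]) ->
    (forall u v, H u -> H v -> u != v -> exists ps : seq (seq G),
      [/\ size ps = k, uniq (flatten ps) &
          {in ps, forall p, path (adj G) u (rcons p v)}]) ->
  k_connected G k.
Proof.
move=> kG fan theta; rewrite /k_connected kG /=.
have avoid (ps : seq (seq G)) X : uniq (flatten ps) -> #|X| < size ps ->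
    exists2 p, p \in ps & {in p, forall z, z \notin X}.
  elim: ps X => [|p ps IH] X //=; rewrite cat_uniq => /and3P[_ ppsN ups].
  rewrite ltnS => Xps; have [/hasP[x xp xX]|/hasPn pX] := boolP (has [in X] p);
    last by exists p; rewrite ?mem_head.
  have [|q qps qX] := IH (X :\ x) ups; first by rewrite (cardsD1 x) xX in Xps.
  exists q => [|z zq]; first by rewrite in_cons qps orbT.
  have := qX z zq; rewrite in_setD1 negb_and negbK => /orP[/eqP zx|//].
  by case/hasP: ppsN; exists z; [apply/flattenP; exists q | rewrite /= zx].
apply/forallP=> X; apply/implyP=> Xk.
have [v vX] := card_lt_exists (ltn_trans Xk kG).
rewrite /connected; apply/andP; split.
  apply/card_gt0P; have vX' : v \in ~: X by rewrite inE.
  by exists (Sub v vX').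
have outX (z : del_vertices X) : val z \notin X by have := valP z; rewrite inE.
have csym := sym_connect_sym (@adj_sym (del_vertices X)).
have to_hub (x : del_vertices X) : exists2 h : del_vertices X,
    H (val h) & connect (adj (del_vertices X)) x h.
  have [Hx|nHx] := boolP (H (val x)); first by exists x.
  have [ps [sps ups psP]] := fan _ nHx.
  have [|p /psP[pth Hl] pX] := avoid ps X ups; first by rewrite sps.
  have lX : last (val x) p \in ~: X.
    rewrite inE; case: (lastP p) pX => [|q z] pX; first exact: outX.
    by rewrite last_rcons pX // mem_rcons mem_head.
  by exists (Sub (last (val x) p) lX) => //; apply: (connect_del_vertices pth).
apply/forallP=> x; apply/forallP=> y.
have [hx Hhx xhx] := to_hub x; have [hy Hhy yhy] := to_hub y.
apply: connect_trans xhx _; rewrite csym; apply: connect_trans yhy _.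
rewrite csym; have [->|ne] := eqVneq hx hy; first exact: connect0.
have [ps [sps ups psP]] := theta _ _ Hhx Hhy ne.
have [|p /psP pth pX] := avoid ps X ups; first by rewrite sps.
apply: (connect_del_vertices pth); rewrite ?last_rcons //.
by move=> z; rewrite mem_rcons in_cons => /orP[/eqP->|/pX].
Qed.

End GraphTheory.

(** * Exhaustive search for a colouring *)

Section ColouringSearch.

Variable rows : seq bitseq.
Implicit Types (D : seq (option (seq nat))) (r : bitseq).

Fixpoint shorter (s t : seq nat) : bool :=
  if t isn't _ :: t' then false else
  if s is _ :: s' then shorter s' t' else true.

(** A heuristic: colouring a most constrained vertex next propagates forced
    colours at once and keeps the search tree small. *)
Fixpoint tightest D (i : nat) (best : seq nat) (j : nat) : nat :=
  if D isn't d :: D' then j else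
  if d isn't Some cs then tightest D' i.+1 best j else
  if shorter cs best then tightest D' i.+1 cs i else tightest D' i.+1 best j.

Fixpoint forbid (c : nat) r D : seq (option (seq nat)) :=
  match D, r with
  | d :: D', b :: r' =>
      (if b then omap (filter (predC1 c)) d else d) :: forbid c r' D'
  | _, _ => D
  end.

(** D gives for every vertex the colours still possible, and None for a vertex
    already coloured. A most constrained vertex is tried with all its colours; a
    vertex without any closes the branch, as all vacuously holds on the empty
    list. The start value of length 4 is longer than any list of three colours,
    and size D is out of range. *)
Fixpoint refutes (n : nat) D : bool :=
  if n isn't n'.+1 then false else
  let i := tightest D 0 (nseq 4 0) (size D) in
  if nth None D i isn't Some cs then false else
  let D' := set_nth None D i None in
  all (fun c => refutes n' (forbid c (nth [::] rows i) D')) cs.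

Definition in_domains (f : nat -> nat) D :=
  forall i cs, nth None D i = Some cs -> f i \in cs.

Lemma in_domains_set f D i :
  in_domains f D -> in_domains f (set_nth None D i None).
Proof.
by move=> fD j cs; rewrite nth_set_nth /=; case: eqP => // _; apply: fD.
Qed.

Lemma in_domains_forbid f c r D : in_domains f D ->
  (forall j, nth false r j -> f j != c) -> in_domains f (forbid c r D).
Proof.
elim: D r f => [|d D IH] r f fD fr //; case: r fr => [|b r] fr //.
case=> [|j] cs /=; last first.
  by apply: (IH r (f \o S)) => [i|i]; [apply: (fD i.+1) | apply: (fr i.+1)].
case: b fr => /= [/(_ 0 isT) f0|_]; last exact: (fD 0).
case: d fD => //= ds /(_ 0 ds erefl) f0ds [<-].
by rewrite mem_filter /= f0.
Qed.

(** A proper colouring f selects at every node of the search the branch for the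
    colour f i, and along these branches f never leaves the domains. *)
Lemma refutesP n D f :
  (forall i j, nth false (nth [::] rows i) j -> f i != f j) ->
  in_domains f D -> ~~ refutes n D.
Proof.
move=> fP; elim: n D => //= n IH D fD.
set i := tightest _ _ _ _; case E: (nth None D i) => [cs|] //.
apply/allPn; exists (f i); first exact: fD E.
apply: IH; apply: in_domains_forbid; first exact: in_domains_set.
by move=> j /fP; rewrite eq_sym.
Qed.

End ColouringSearch.

(** * Branch and bound for independent sets *)

Section IndependentSetSearch.

Variables (T : eqType) (e : rel T).
Implicit Types (o : seq T) (R r : bitseq) (rs : seq bitseq) (S : pred T).

(** The upper triangle of the adjacency matrix in the order o: the search treats
    the vertices in this order and compares each one only with those after it,
    so that all lists can be traversed in parallel. *)
Fixpoint later o : seq bitseq :=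
  if o is u :: o' then map (e u) o' :: later o' else [::].

Fixpoint drop_first R r : bitseq :=
  match R, r with
  | b :: R', c :: r' =>
      if c then if b then false :: R' else b :: drop_first R' r'
      else b :: drop_first R' r'
  | _, _ => R
  end.

Fixpoint drop_all R r : bitseq :=
  match R, r with
  | b :: R', c :: r' => (if c then false else b) :: drop_all R' r'
  | _, _ => R
  end.

(** Pairs the first vertex of the mask R with its first neighbour in R, if any,
    and goes on with the others. This covers R by edges and single vertices,
    each of which meets an independent set at most once; the test asks for at
    most k of them. *)
Fixpoint matching_bound R rs k : bool :=
  match R, rs with
  | b :: R', r :: rs' =>
      if b then
        if k is k'.+1 then matching_bound (drop_first R' r) rs' k' else false
      else matching_bound R' rs' k
  | _, _ => true
  end.

(** Unless the matching bound suffices, splits on the first vertex of R: an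
    independent set omits it, or contains it and loses its neighbours.
    Conditionals replace the Boolean connectives, whose two arguments would both
    be computed in a call-by-value evaluation. *)
Fixpoint branching_bound R rs k : bool :=
  if matching_bound R rs k then true else
  match R, rs with
  | b :: R', r :: rs' =>
      if branching_bound R' rs' k then
        if b then
          if k is k'.+1 then branching_bound (drop_all R' r) rs' k' else false
        else true
      else false
  | _, _ => false
  end.

Definition within S o R := all2 (fun x b => S x ==> b) o R.

(** When S omits u, the vertex paired off with u may still be an element of S:
    it is the w given up here. *)
Lemma within_drop_first S o R u : within S o R ->
  exists w, within (predD1 S w) o (drop_first R (map (e u) o)).
Proof.
rewrite /within; elim: o R => [|v o IH] [|b R] //=.
case/andP=> Svb /[dup] SoR /IH[w woR].
have sub x : all2 (fun y b => predD1 S x y ==> b) o R.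
  elim: (o) (R) SoR => [|y o' IH'] [|a R'] //= /andP[ya /IH'->].
  by rewrite andbT; apply/implyP=> /andP[_]; apply/implyP.
have stay x : predD1 S x v ==> b.
  by apply/implyP=> /andP[_]; apply/implyP.
case: (e u v); last by exists w; rewrite /= stay.
case: b {Svb} stay => [_|stay]; last by exists w; rewrite /= stay.
by exists v; rewrite /= eqxx /= sub.
Qed.

Lemma within_drop_all S o R u :
    S u -> (forall x y, S x -> S y -> ~~ e x y) ->
  within S o R -> within S o (drop_all R (map (e u) o)).
Proof.
move=> Su Sind; rewrite /within; elim: o R => [|v o IH] [|b R] //=.
case/andP=> Svb /IH->; rewrite andbT; case: ifP => // uv; rewrite implybF.
by apply/negP=> /(Sind u v Su); rewrite uv.
Qed.

(** When S contains u, the erased vertex is a neighbour of u and hence not in S,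
    so S stays within the mask. *)
Lemma within_drop_first_nbr S o R u :
    S u -> (forall x y, S x -> S y -> ~~ e x y) ->
  within S o R -> within S o (drop_first R (map (e u) o)).
Proof.
move=> Su Sind; rewrite /within; elim: o R => [|v o IH] [|b R] //=.
case/andP=> Svb SoR; case: ifP => [uv|_]; last by rewrite /= Svb IH.
have /negPf Sv : ~~ S v by apply/negP=> /(Sind u v Su); rewrite uv.
by case: (b); rewrite /= Sv //= IH.
Qed.

Lemma matching_boundP S o R k :
    uniq o -> (forall x y, S x -> S y -> ~~ e x y) -> within S o R ->
  matching_bound R (later o) k -> count S o <= k.
Proof.
elim: o S R k => [|u o IH] S [|b R] k //= /andP[_ uo] Sind /andP[Sub SoR].
case: b Sub => [_|]; last by rewrite implybF => /negbTE->; apply: IH.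
case: k => // k bound; have [Su|nSu] := boolP (S u).
  by rewrite add1n ltnS; apply: IH bound => //; apply: within_drop_first_nbr.
have [w wo] := within_drop_first u SoR.
rewrite add0n; apply: (@leq_trans (count (predD1 S w) o).+1).
  have -> : count S o = count (predI S (pred1 w)) o + count (predD1 S w) o.
    elim: (o) => //= x s ->; rewrite addnACA; congr (_ + _).
    by case: eqP; case: (S x).
  rewrite -add1n leq_add2r; apply: leq_trans (leq_b1 (w \in o)).
  by rewrite -count_uniq_mem //; apply: sub_count => x /andP[].
by rewrite ltnS; apply: IH bound => // x y /andP[_ Sx] /andP[_ Sy]; apply: Sind.
Qed.

Lemma branching_boundP S o R k :
    uniq o -> (forall x y, S x -> S y -> ~~ e x y) -> within S o R ->
  branching_bound R (later o) k -> count S o <= k.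
Proof.
elim: o R k => [|u o IH] [|b R] k // uo Sind SoR.
rewrite [branching_bound _ _ _]/=; case: ifP => [mb _|_].
  exact: (@matching_boundP S (u :: o) (b :: R) k).
have /= /andP[_ uo'] := uo; have /= /andP[Sub SoR'] := SoR.
case: ifP => // without; have [Su|nSu] := boolP (S u); last first.
  by move=> _; apply: IH without.
rewrite Su in Sub; case: b Sub {SoR} => //= _; case: k without => // k _.
by rewrite add1n ltnS; apply: IH => //; apply: within_drop_all.
Qed.

End IndependentSetSearch.

(** * Searches along neighbour lists: short cycles and automorphisms *)

Section NeighbourSearch.

Variables (T : eqType) (nb : T -> seq T).
Implicit Types (o vis : seq T) (P : seq (T * T)).

(** Called with vis made of y and x, where xy is an arc: a positive answer
    excludes all cycles through this arc of length at most n + 2. *)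
Fixpoint never_closes (n : nat) (x : T) vis (y : T) : bool :=
  if n isn't n'.+1 then true else
  all (fun z => if z \in vis then true else
                if x \in nb z then false else never_closes n' x (z :: vis) z)
      (nb y).

Lemma never_closesP n x vis y z p :
    never_closes n x vis y -> path (fun u v => v \in nb u) y (z :: p) ->
    uniq (z :: p) -> ~~ has [in vis] (z :: p) -> size p < n ->
  x \notin nb (last z p).
Proof.
elim: n vis y z p => // n IH vis y z p /= /allP nc /andP[yz zp].
case/andP=> zp' up; rewrite negb_or => /andP[zvis pvis] szp.
have := nc z yz; rewrite (negbTE zvis); case: ifP => // xz {}nc.
case: p zp zp' up pvis szp => [|t p] zp zp' up pvis szp; first by rewrite /= xz.
apply: (IH _ _ _ _ nc zp up) => //.
apply/hasPn=> s sp; rewrite in_cons negb_or (hasPn pvis) // andbT.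
by apply: contraNneq zp' => <-.
Qed.

Lemma no_short_cycle n s x y : never_closes n x [:: y; x] y ->
  [&& 2 < size (x :: y :: s), uniq (x :: y :: s) &
      path.cycle (fun u v => v \in nb u) (x :: y :: s)] ->
  n < size s.
Proof.
case: s => [|z s] // nc /and3P[_] /=; rewrite rcons_path.
case/and3P; rewrite !in_cons !negb_or => /and3P[_ xz xs] /andP[yz ys].
case/andP=> zs us /and4P[xy yzE zsP cl]; rewrite ltnNge; apply/negP=> sn.
have /negP[] : x \notin nb (last z s); last exact: cl.
apply: (never_closesP nc) => //=; rewrite ?yzE ?zsP ?zs ?us //.
rewrite !inE !negb_or ![z == _]eq_sym xz yz /=.
by apply/hasPn=> t ts; rewrite !inE negb_or; apply/andP; split;
   apply: contraTneq ts => ->.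
Qed.

Definition fits P (v w : T) : bool :=
  if size (nb v) == size (nb w)
  then all (fun p => (v \in nb p.1) == (w \in nb p.2)) P
  else false.

(** P is a partial automorphism, given as a list of pairs, and o lists the
    vertices where it has to be extended. Each vertex of o must have a neighbour
    in the domain of P, so that only the neighbours of one vertex are possible
    images. The answer is positive if all completed maps are the identity. *)
Fixpoint rigid o P : bool :=
  if o isn't v :: o' then all (fun p => p.1 == p.2) P else
  if [seq p.2 | p <- P & v \in nb p.1] is y :: _ then
    all (fun w => if fits P v w then rigid o' ((v, w) :: P) else true) (nb y)
  else false.

(** An automorphism s that extends P passes the test at each pair of a vertex
    and its image, so the search follows it down to a completed map. *)
Lemma rigidP (s : T -> T) o P :
    (forall u v, (s v \in nb (s u)) = (v \in nb u)) ->
    (forall u, size (nb (s u)) = size (nb u)) ->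
    rigid o P -> {in P, forall p, s p.1 = p.2} ->
  {in o, forall v, s v = v} /\ {in P, forall p, s p.1 = p.1}.
Proof.
move=> sE sS; elim: o P => [|v o IH] P /=.
  by move=> /allP PP sP; split=> // p pP; rewrite sP //; apply/esym/eqP/PP.
case E: [seq _ | _ <- _ & _] => [|y t] // /allP all_w sP.
have svy : s v \in nb y.
  have /mapP[p] : y \in [seq p.2 | p <- P & v \in nb p.1] by rewrite E mem_head.
  by rewrite mem_filter => /andP[vp pP] ->; rewrite -sP // sE.
have fit : fits P v (s v).
  by rewrite /fits sS eqxx; apply/allP=> p pP; rewrite -sP // sE.
have := all_w _ svy; rewrite fit => /IH[p|so sP'].
  by rewrite in_cons => /orP[/eqP->|/sP].
split=> [u|p pP]; last by apply: sP'; rewrite in_cons pP orbT.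
rewrite in_cons => /orP[/eqP->|/so //].
by apply: (sP' (v, s v)); rewrite mem_head.
Qed.

End NeighbourSearch.

(** * The adjacency of G64 on natural numbers *)

Definition arc_ends (u : nat) : seq nat :=
  [seq (u + p.2) %% 64 | p <- G64_pairs & u %% 8 == p.1 %% 8].

(** Computed once, so that every later search reads neighbours from a list and
    never computes in the ring of integers modulo 64. *)
Definition G64_table : seq (seq nat) := Eval vm_compute in
  let ends := [seq arc_ends u | u <- iota 0 64] in
  [seq [seq v <- iota 0 64 | (v \in nth [::] ends u) || (u \in nth [::] ends v)]
     | u <- iota 0 64].

Definition nb (u : nat) : seq nat := nth [::] G64_table u.

Definition nat_adj (u v : nat) : bool := v \in nb u.

Lemma val_add (u : 'Z_64) n : val (u + n%:R)%R = (u + n) %% 64.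
Proof. by rewrite /= val_Zp_nat // modnDmr. Qed.

Definition vtx (n : nat) : G64 := (n%:R)%R.

Lemma val_lt (v : G64) : val v < 64.
Proof. exact: ltn_ord v. Qed.

Lemma val_vtx n : val (vtx n) = n %% 64.
Proof. by rewrite /= val_Zp_nat. Qed.

Lemma vtxK n : n < 64 -> val (vtx n) = n.
Proof. by move=> n64; rewrite val_vtx modn_small. Qed.

Lemma valK_vtx (v : G64) : vtx (val v) = v.
Proof. exact: natr_Zp. Qed.

Lemma val_vtxs p : all (ltn^~ 64) p -> map val (map vtx p) = p.
Proof.
move/allP=> p64; rewrite -map_comp; apply: map_id_in => n /p64; exact: vtxK.
Qed.

Lemma arcE (u v : 'Z_64) : G64_arc u v = (val v \in arc_ends u).
Proof.
apply/hasP/mapP => [[p pP /andP[up /eqP->]]|[p]].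
  by exists p; rewrite ?val_add // mem_filter up.
rewrite mem_filter => /andP[up pP] E; exists p => //; rewrite up /=.
by apply/eqP/val_inj; rewrite val_add.
Qed.

Lemma nbE u v : u < 64 -> v < 64 ->
  (v \in nb u) = (v \in arc_ends u) || (u \in arc_ends v).
Proof.
move=> u64 v64; rewrite /nb; have -> : G64_table =
  let ends := [seq arc_ends u | u <- iota 0 64] in
  [seq [seq v <- iota 0 64 | (v \in nth [::] ends u) || (u \in nth [::] ends v)]
     | u <- iota 0 64] by vm_compute.
rewrite (nth_map 0) ?size_iota // nth_iota // mem_filter mem_iota v64 andbT.
by rewrite !(nth_map 0) ?size_iota // !nth_iota // !add0n andbT.
Qed.

Lemma adjE (u v : G64) : adj G64 u v = nat_adj (val u) (val v).
Proof. by rewrite /nat_adj nbE ?val_lt // -!arcE. Qed.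

Lemma nb_uniq u : uniq (nb u).
Proof.
have [u64|u64] := ltnP u 64; last by rewrite /nb nth_default.
have /allP/(_ (nb u)) : all uniq G64_table by [].
by apply; apply: mem_nth.
Qed.

Lemma nb_lt u v : v \in nb u -> v < 64.
Proof.
have [u64|u64] := ltnP u 64; last by rewrite /nb nth_default.
have /allP/(_ (nb u)) : all (all (ltn^~ 64)) G64_table by [].
by move=> /(_ (@mem_nth _ [::] G64_table u u64)) /allP nb64 /nb64.
Qed.

Lemma nb_dom u v : v \in nb u -> u < 64.
Proof. by rewrite ltnNge; apply: contraL => u64; rewrite /nb nth_default. Qed.

Lemma all_vertices (P : pred nat) (v : G64) : all P (iota 0 64) -> P (val v).
Proof. by move/allP; apply; rewrite mem_iota val_lt. Qed.

Lemma card_vals (s : seq nat) : uniq s -> all (ltn^~ 64) s ->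
  #|[set v : G64 | val v \in s]| = size s.
Proof.
move=> us /allP s64; rewrite -(size_map vtx).
have valK : {in s, cancel vtx val}.
  by move=> n /s64; apply: vtxK.
rewrite -(card_uniqP _); last first.
  by rewrite map_inj_in_uniq //; apply: can_in_inj valK.
apply: eq_card => v; rewrite inE; apply/idP/mapP => [vs|[n ns ->]].
  by exists (val v); rewrite ?valK_vtx.
by rewrite valK.
Qed.

Lemma card_val_pred (P : pred nat) :
  #|[set v : G64 | P (val v)]| = count P (iota 0 64).
Proof.
rewrite -size_filter -card_vals ?filter_uniq ?iota_uniq //.
  apply: eq_card => v; rewrite !inE mem_filter mem_iota andb_idr // => _.
  exact: val_lt.
by apply/allP=> n; rewrite mem_filter mem_iota => /and3P[].
Qed.

Lemma card_G64 : #|G64| = 64.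
Proof. exact: card_ord. Qed.

Lemma degreeE (v : G64) : degree v = size (nb (val v)).
Proof.
rewrite -card_vals ?nb_uniq //; last by apply/allP=> w /nb_lt.
by apply: eq_card => w; rewrite !inE adjE.
Qed.

Lemma card_degree d :
  #|[set v : G64 | degree v == d]| =
  count (fun n => size (nb n) == d) (iota 0 64).
Proof.
by rewrite -card_val_pred; apply: eq_card => v; rewrite !inE degreeE.
Qed.

Lemma card_edges_G64 : #|edges G64| = 152.
Proof.
apply/eqP; rewrite -(eqn_pmul2l (m := 2)) // -handshake; apply/eqP.
rewrite (eq_bigr (fun v : G64 => size (nb (val v)))) => [|v _]; last first.
  exact: degreeE.
by rewrite -(big_mkord xpredT (fun n => size (nb n))) unlock.
Qed.

Lemma degree_ge4 (v : G64) : 4 <= degree v.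
Proof.
by rewrite degreeE; apply: (@all_vertices (fun n => 4 <= size (nb n))).
Qed.

Lemma degree2 : degree (vtx 2) = 4.
Proof. by rewrite degreeE vtxK. Qed.

(** * Girth *)

Lemma is_cycleE (s : seq G64) : is_cycle s =
  [&& 2 < size (map val s), uniq (map val s) & path.cycle nat_adj (map val s)].
Proof.
rewrite /is_cycle size_map (map_inj_uniq val_inj) cycle_map.
by rewrite (eq_cycle (e' := relpre val nat_adj)) // => u v; apply: adjE.
Qed.

Lemma G64_no_short_cycle :
  all (fun x => all (fun y => never_closes nb 3 x [:: y; x] y) (nb x))
    (iota 0 64).
Proof. by vm_compute. Qed.

(** A cycle of length at most 5 through the arc xy would be a path of at most
    three further vertices that returns to a neighbour of x. *)
Lemma cycle_size (s : seq G64) : is_cycle s -> 6 <= size s.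
Proof.
rewrite is_cycleE -(size_map val).
case: s => [|x [|y s]] // Hc; have /and3P[_ _ /= /andP[xy _]] := Hc.
have := all_vertices x G64_no_short_cycle => /allP/(_ _ xy)/no_short_cycle.
exact.
Qed.

Lemma cycle6 : @is_cycle G64 ([:: 0; 40; 36; 44; 34; 15]%R : seq 'Z_64).
Proof.
have -> : ([:: 0; 40; 36; 44; 34; 15]%R : seq 'Z_64) =
          map vtx [:: 0; 40; 36; 44; 34; 15] by [].
by rewrite is_cycleE val_vtxs.
Qed.

Lemma girth_G64 : girth G64 = Some 6.
Proof.
apply: girthE => [|m /existsP[s /cycle_size]]; last by rewrite size_tuple.
apply/existsP; exists [tuple of [:: 0; 40; 36; 44; 34; 15]%R : seq 'Z_64].
exact: cycle6.
Qed.

(** * Connectivity *)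

(** For u = 1, ..., 7 at position u: four paths from u, with u left out, to
    distinct multiples of 8; they share only u. The other vertices are obtained
    by rotation. *)
Definition fans : seq (seq (seq nat)) := [::
    [::];
    [:: [:: 16]; [:: 23; 8]; [:: 39; 24]; [:: 43; 60; 0]];
    [:: [:: 12; 16]; [:: 34; 44; 48]; [:: 47; 32]; [:: 54; 49; 0]];
    [:: [:: 20; 24]; [:: 25; 40]; [:: 35; 52; 56]; [:: 45; 23; 8]];
    [:: [:: 8]; [:: 12; 16]; [:: 51; 9; 24]; [:: 60; 0]];
    [:: [:: 6; 1; 16]; [:: 27; 44; 48]; [:: 46; 41; 56]; [:: 47; 32]];
    [:: [:: 1; 16]; [:: 5; 47; 32]; [:: 13; 55; 40]; [:: 18; 63; 48]];
    [:: [:: 26; 36; 40]; [:: 33; 48]; [:: 49; 0]; [:: 56]]].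

(** At position d: the interiors of four internally disjoint paths from 0 to
    8d. An empty interior stands for an edge. *)
Definition thetas : seq (seq (seq nat)) := [::
    [::];
    [:: [:: 15; 57]; [:: 24; 48]; [:: 49; 23]; [:: 60; 4]];
    [:: [:: 15; 41; 56]; [:: 24; 9; 31]; [:: 40]; [:: 49; 23; 1]];
    [:: [:: 15; 34; 44; 48]; [::]; [:: 40; 16; 1; 39]; [:: 60; 4; 12; 20]];
    [:: [:: 15; 41; 56]; [:: 24; 9; 47]; [:: 40; 36; 28]; [:: 49; 23; 8]];
    [:: [:: 15; 34; 44; 36]; [:: 24; 9; 31; 16]; [::]; [:: 49; 7; 33; 55]];
    [:: [:: 15; 34; 44]; [:: 24]; [:: 40; 25; 63]; [:: 49; 7; 33]];
    [:: [:: 15; 41]; [:: 40; 16]; [:: 49; 7]; [:: 60; 52]]].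

Definition shift (k : nat) (p : seq nat) : seq nat :=
  [seq (x + k) %% 64 | x <- p].

Definition fan (u : nat) :=
  [seq shift (u - u %% 8) p | p <- nth [::] fans (u %% 8)].

Definition theta (u v : nat) :=
  [seq shift u p | p <- nth [::] thetas ((v + (64 - u)) %% 64 %/ 8)].

Lemma fans_ok : all (fun u => if 8 %| u then true else
    [&& size (fan u) == 4, uniq (flatten (fan u)) &
        all (fun p => [&& path nat_adj u p, 8 %| last u p & all (ltn^~ 64) p])
            (fan u)])
  (iota 0 64).
Proof. by vm_compute. Qed.

Lemma thetas_ok : all (fun u => all (fun v => if u == v then true else
    [&& size (theta u v) == 4, uniq (flatten (theta u v)) &
        all (fun p => path nat_adj u (rcons p v) && all (ltn^~ 64) p)
            (theta u v)])
  [seq 8 * k | k <- iota 0 8]) [seq 8 * k | k <- iota 0 8].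
Proof. by vm_compute. Qed.

Lemma path_vtx (u : G64) p : all (ltn^~ 64) p ->
  path (adj G64) u (map vtx p) = path nat_adj (val u) p.
Proof.
move=> p64; rewrite -{2}(val_vtxs p64) path_map.
by apply: eq_path => x y; apply: adjE.
Qed.

Lemma flatten_map_vtx ps : all (all (ltn^~ 64)) ps ->
  uniq (flatten ps) -> uniq (flatten (map (map vtx) ps)).
Proof.
move=> /allP ps64 ups; rewrite -map_flatten map_inj_in_uniq //.
move=> m n /flattenP[p /ps64/allP p64 /p64 m64].
case/flattenP=> q /ps64/allP q64 /q64 n64.
by move/(congr1 val); rewrite !vtxK.
Qed.

(** The hub is the orbit of 0 under the rotation, that is, the multiples of
    8. *)
Lemma G64_4_connected : k_connected G64 4.
Proof.
pose H (v : G64) := 8 %| val v.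
apply: (@k_connected_hub G64 H 4) => [|u hu|u v hu hv uv].
- by rewrite card_G64.
- have := all_vertices u fans_ok; rewrite -/(H u) (negbTE hu).
  case/and3P=> /eqP sz un /allP ok; exists (map (map vtx) (fan (val u))).
  split; first by rewrite size_map.
    by apply: flatten_map_vtx => //; apply/allP=> p /ok/and3P[].
  move=> _ /mapP[p /ok/and3P[pth lst p64] ->]; rewrite path_vtx // pth.
  by rewrite /H -(last_map val) val_vtxs.
- have hub (w : G64) : 8 %| val w -> val w \in [seq 8 * k | k <- iota 0 8].
    move=> /dvdnP[k E]; apply/mapP; exists k; rewrite ?E 1?mulnC // mem_iota /=.
    by rewrite -(ltn_pmul2r (m := 8)) // -E val_lt.
  have := allP (allP thetas_ok _ (hub u hu)) _ (hub v hv).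
  rewrite (inj_eq val_inj) (negbTE uv).
  case/and3P=> /eqP sz un /allP ok.
  exists (map (map vtx) (theta (val u) (val v))).
  split; first by rewrite size_map.
    by apply: flatten_map_vtx => //; apply/allP=> p /ok/andP[].
  move=> _ /mapP[p /ok/andP[pth p64] ->].
  have -> : v = vtx (val v) by rewrite valK_vtx.
  by rewrite -map_rcons path_vtx // all_rcons p64 andbT; apply: val_lt.
Qed.

(** * Chromatic number *)

Definition G64_rows : seq bitseq :=
  [seq let r := nb u in [seq v \in r | v <- iota 0 64] | u <- iota 0 64].

(** Vertices 0 and 40 are adjacent; the names of the colours can be chosen so
    that they get 0 and 1. This divides the search by six. *)
Definition seeded_domains : seq (option (seq nat)) :=
  [seq Some (if v == 0 then [:: 0] else
             if v == 40 then [:: 1] else [:: 0; 1; 2]) | v <- iota 0 64].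

Lemma seeded_refuted : refutes G64_rows 65 seeded_domains.
Proof. by vm_cast_no_check (erefl true). Qed.

Lemma G64_rows_adj i j : nth false (nth [::] G64_rows i) j -> j \in nb i.
Proof.
have [i64|i64] := ltnP i 64; last by rewrite (nth_default [::]) ?nth_nil.
rewrite (nth_map 0) ?size_iota // nth_iota //.
have [j64|j64] := ltnP j 64; last by rewrite nth_default // size_map size_iota.
by rewrite (nth_map 0) ?size_iota // nth_iota.
Qed.

Lemma perm_send01 (a b : 'I_3) :
  a != b -> exists s : 'S_3, s a = 0 :> nat /\ s b = 1 :> nat.
Proof.
move=> ab; pose i0 : 'I_3 := inord 0; pose i1 : 'I_3 := inord 1.
have b0 : tperm a i0 b != i0.
  by rewrite -[X in _ != X](tpermL a i0) (inj_eq perm_inj) eq_sym.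
have i10 : i1 != i0 by rewrite -(inj_eq val_inj) /= !inordK.
exists (tperm a i0 * tperm (tperm a i0 b) i1)%g; rewrite !permM !tpermL.
by rewrite (tpermD b0 i10) /i0 /i1 !inordK.
Qed.

Lemma G64_not_3_colorable : ~~ colorable G64 3.
Proof.
apply/existsP=> -[f /forallP fP].
have fne (x y : G64) : adj G64 x y -> f x != f y.
  by move=> xy; apply: (implyP (forallP (fP x) y)).
have f040 : f (vtx 0) != f (vtx 40) by apply: fne; rewrite adjE !vtxK.
have [s [s0 s1]] := perm_send01 f040.
have := seeded_refuted; apply/negP.
apply: (@refutesP _ _ _ (fun n => val (s (f (vtx n))))).
  move=> i j /G64_rows_adj ij.
  rewrite (inj_eq val_inj) (inj_eq perm_inj); apply: fne.
  by rewrite adjE !vtxK ?(nb_lt ij) ?(nb_dom ij).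
move=> i cs; have [i64|i64] := ltnP i 64; last by rewrite nth_default.
rewrite (nth_map 0) ?size_iota // nth_iota // add0n => -[<-].
case: eqP => [->|_]; first by rewrite inE; apply/eqP.
case: eqP => [->|_]; first by rewrite inE; apply/eqP.
by case: (s _) => -[|[|[|]]].
Qed.

Lemma G64_4_coloring : @proper_coloring G64 4 c64.
Proof.
pose c := nth 0 c64_values.
have H : all (fun u => all (fun v => c u != c v) (nb u)) (iota 0 64).
  by vm_compute.
have c4 n : c n < 4.
  have [n64|n64] := ltnP n 64; last by rewrite /c nth_default.
  by have /all_nthP : all (ltn^~ 4) c64_values by []; apply.
apply/forallP=> u; apply/forallP=> v; apply/implyP; rewrite adjE => uv.
by rewrite -(inj_eq val_inj) /= !inordK //; apply: (allP (all_vertices u H)).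
Qed.

Lemma chromatic_number_G64 : chromatic_number G64 = 4.
Proof.
apply/eqP; rewrite eqn_leq chromatic_number_leq ltnNge chromatic_number_leq.
rewrite G64_not_3_colorable andbT; apply/existsP; exists (finfun c64).
apply/forallP=> x; apply/forallP=> y; rewrite !ffunE.
exact: forallP (forallP G64_4_coloring x) y.
Qed.

(** * Independence number *)

(** An order of the vertices for which the branch and bound search has a small
    tree (about 1200 nodes). *)
Definition search_order : seq nat :=
  [:: 44; 6; 53; 0; 56; 4; 45; 63; 9; 28; 57; 29; 47; 23; 5; 3; 8; 25; 41; 15;
      34; 31; 16; 48; 40; 32; 50; 18; 49; 60; 35; 46; 52; 43; 27; 54; 22; 2;
      24; 19; 20; 51; 11; 1; 39; 13; 12; 36; 38; 58; 61; 7; 62; 21; 55; 33;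
      17; 42; 10; 30; 14; 26; 37; 59].

Definition large_independent : seq nat :=
  [:: 0; 2; 3; 4; 5; 7; 9; 10; 11; 13; 16; 18; 21; 23; 30; 32; 36; 38; 39; 41;
      48; 52; 57; 59].

Lemma independent_bound :
  branching_bound (nseq 64 true) (later nat_adj search_order) 24.
Proof. by vm_cast_no_check (erefl true). Qed.

Lemma within_full S (o : seq nat) : within S o (nseq (size o) true).
Proof. by rewrite /within; elim: o => //= x o ->; rewrite implybT. Qed.

Lemma independence_number_G64 : independence_number G64 = 24.
Proof.
apply/eqP; rewrite eqn_leq; apply/andP; split.
  apply/bigmax_leqP=> S /forallP Sind.
  have o64 : perm_eq search_order (iota 0 64) by [].
  have -> : #|S| = count (fun n => vtx n \in S) search_order.
    rewrite (seq.permP o64) -card_val_pred.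
    by apply: eq_card => v; rewrite inE valK_vtx.
  apply: (@branching_boundP _ nat_adj _ search_order (nseq 64 true)).
  - by rewrite (perm_uniq o64) iota_uniq.
  - move=> x y xS yS; apply/negP=> xy.
    have := implyP (Sind (vtx x)) xS => /forallP/(_ (vtx y))/implyP/(_ yS).
    by rewrite adjE !vtxK ?(nb_lt xy) ?(nb_dom xy) // xy.
  - exact: within_full.
  - exact: independent_bound.
pose I := [set v : G64 | val v \in large_independent].
have <- : #|I| = 24 by apply: card_vals.
apply: (bigmax_sup I) => //.
have ind : all (fun u => all (fun v => ~~ nat_adj u v) large_independent)
               large_independent by vm_compute.
apply/forall_inP=> u; rewrite inE => uI.
apply/forall_inP=> v; rewrite inE => vI.
by rewrite adjE (allP (allP ind _ uI)).
Qed.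

(** * Automorphism group *)

Lemma rot8X k (v : G64) : (rot8 ^+ k)%g v = (v + (8 * k)%:R :> 'Z_64)%R.
Proof.
elim: k => [|k IH]; first by rewrite expg0 perm1 muln0 mulr0n addr0.
by rewrite expgSr permM IH permE -addrA -natrD -mulnSr.
Qed.

Lemma val_rot8X k (v : G64) : val ((rot8 ^+ k)%g v) = (val v + 8 * k) %% 64.
Proof. by rewrite rot8X val_add. Qed.

Lemma rot8_aut : rot8 \in graph_aut G64.
Proof.
rewrite inE; apply/forallP=> u; apply/forallP=> v; apply/eqP.
suff arcR (x y : 'Z_64) : G64_arc (rot8 x) (rot8 y) = G64_arc x y.
  by rewrite /= /G64_adj !arcR.
rewrite /G64_arc; apply: eq_has => p; rewrite !permE; congr (_ && _).
  by rewrite (val_add x 8) modn_dvdm // modnDr.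
by rewrite addrAC (inj_eq (addIr _)).
Qed.

Lemma rot8X_aut k : (rot8 ^+ k)%g \in graph_aut G64.
Proof. by rewrite groupX ?rot8_aut. Qed.

Lemma rot8_cycle : <[rot8]>%g \subset graph_aut G64.
Proof. by rewrite cycle_subG rot8_aut. Qed.

Lemma order_rot8 : #[rot8]%g = 8.
Proof.
have E n : (#[rot8]%g %| n) = (8 %| n).
  rewrite order_dvdn; apply/eqP/idP => [rn|/dvdnP[m ->]].
    have := congr1 (fun s : {perm G64} => val (s (vtx 0))) rn.
    rewrite val_rot8X perm1 vtxK // add0n.
    by move/eqP; rewrite -[X in _ %% X]/(8 * 8) -/(dvdn _ _) dvdn_pmul2l.
  apply/permP=> v; apply: val_inj; rewrite val_rot8X perm1 [m * 8]mulnC mulnA.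
  by rewrite -modnDmr modnMr addn0 modn_small ?val_lt.
by apply/eqP; rewrite eqn_dvd E dvdnn -E dvdnn.
Qed.

(** Starting at 6, this order closes many 6-cycles early, which rules out most
    partial maps after a few steps. *)
Definition rigid_order : seq nat :=
  [:: 18; 28; 11; 1; 43; 60; 50; 63; 21; 31; 53; 16; 46; 5; 41; 56; 32; 47;
      62; 52; 25; 40; 0; 30; 36; 57; 15; 19; 29; 42; 8; 23; 7; 49; 10; 22; 45;
      27; 44; 48; 34; 33; 38; 55; 61; 54; 13; 17; 2; 37; 39; 24; 59; 20; 12;
      14; 9; 51; 4; 3; 35; 58; 26].

Lemma rigid_search : all (fun w => rigid nb rigid_order [:: (6, w)]) (iota 0 8).
Proof. by vm_compute. Qed.

(** A rotation brings the image of 6 into {0, ..., 7}, so this normalisation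
    loses nothing. *)
Lemma aut_fixed (s : {perm G64}) : s \in graph_aut G64 ->
  val (s (vtx 6)) < 8 -> s = 1%g.
Proof.
move=> sA s6; have sP := graph_autP sA.
(* Outside the vertices t is the identity, and the adjacency lists are empty
   there: this makes t an automorphism on all natural numbers, as the search
   demands. *)
pose t n := if n < 64 then val (s (vtx n)) else n.
have tE (v : G64) : t (val v) = val (s v) by rewrite /t val_lt valK_vtx.
have tout n : 64 <= n -> t n = n by rewrite leqNgt /t => /negbTE->.
have tP u v : (t v \in nb (t u)) = (v \in nb u).
  have [u64|u64] := ltnP u 64; last first.
    by rewrite (tout u) // /nb nth_default.
  have [v64|v64] := ltnP v 64; last first.
    by rewrite (tout v) //; apply/idP/idP => /nb_lt; rewrite ltnNge v64.
  by rewrite -(vtxK u64) -(vtxK v64) !tE -!/(nat_adj _ _) -!adjE sP.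
have tS u : size (nb (t u)) = size (nb u).
  have [u64|u64] := ltnP u 64; last by rewrite tout.
  by rewrite -(vtxK u64) tE -!degreeE degree_aut.
have t6 : rigid nb rigid_order [:: (6, t 6)].
  by apply: (allP rigid_search); rewrite mem_iota.
have [p|fix_o fix_6] := rigidP tP tS t6; first by rewrite inE => /eqP->.
apply/permP=> v; apply: val_inj; rewrite perm1 -tE.
have : val v \in 6 :: rigid_order.
  have /perm_mem-> : perm_eq (6 :: rigid_order) (iota 0 64) by [].
  by rewrite mem_iota val_lt.
rewrite in_cons => /orP[/eqP->|/fix_o //].
exact: (fix_6 (6, t 6) (mem_head _ _)).
Qed.

Lemma graph_autE : graph_aut G64 = <[rot8]>%g.
Proof.
apply/eqP; rewrite eqEsubset rot8_cycle andbT; apply/subsetP=> s sA.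
(* Adding 8k cancels, modulo 64, the multiple of 8 in the image of 6. *)
pose k := 8 - val (s (vtx 6)) %/ 8.
suff s1 : (s * rot8 ^+ k = 1)%g.
  by rewrite -(mulgK (rot8 ^+ k)%g s) s1 mul1g groupV mem_cycle.
apply: aut_fixed; first by rewrite groupM ?rot8X_aut.
rewrite permM val_rot8X /k.
have : val (s (vtx 6)) < 64 := val_lt _; move: (val _) => n n64.
have n8 : n %/ 8 < 8 by rewrite ltn_divLR.
rewrite {1}(divn_eq n 8) addnAC mulnC -mulnDr subnKC ?(ltnW n8) //.
by rewrite modnDl modn_small ?ltn_pmod // (leq_trans (ltn_pmod _ _)).
Qed.

(** * Critical edges and vertices *)

Definition base_edge (p : nat * nat) : {set G64} :=
  [set vtx p.1; vtx (p.1 + p.2)].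

Definition rot_edge k (p : nat * nat) : {set G64} :=
  [set (rot8 ^+ k)%g (vtx p.1); (rot8 ^+ k)%g (vtx (p.1 + p.2))].

Lemma pairs_lt8 p : p \in G64_pairs -> p.1 < 8.
Proof. by have /allP H : all (fun p => p.1 < 8) G64_pairs by []; apply: H. Qed.

Lemma pairs_lt64 p : p \in G64_pairs -> p.1 < 64.
Proof. by move/pairs_lt8=> p8; apply: ltn_trans p8 _. Qed.

Lemma edge_rot (e : {set G64}) : e \in edges G64 ->
  exists p k, p \in G64_pairs /\ e = rot_edge k p.
Proof.
suff arc_rot (u v : G64) : G64_arc u v ->
    exists p k, p \in G64_pairs /\ [set u; v] = rot_edge k p.
  case/edgesP=> u [v [uv ->]].
  have /orP[/arc_rot //|/arc_rot[p [k [pP E]]]] := uv.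
  by exists p, k; rewrite setUC.
case/hasP=> p pP /andP[/eqP up /eqP ->]; exists p, (val u %/ 8); split=> //.
have p8 := pairs_lt8 pP.
have uE : u = (rot8 ^+ (val u %/ 8))%g (vtx p.1).
  apply: val_inj; rewrite val_rot8X vtxK; last exact: pairs_lt64.
  rewrite -(modn_small p8) -up addnC mulnC -divn_eq modn_small //.
  exact: val_lt.
rewrite /rot_edge -uE; congr [set _; _].
by rewrite {1}uE !rot8X /vtx natrD addrAC.
Qed.

(** The i-th list is a 3-colouring of G64 without the i-th base edge. *)
Definition edge_colorings : seq (seq nat) := [::
    [:: 0; 2; 0; 0; 0; 2; 0; 0; 1; 0; 1; 0; 1; 2; 1; 0; 0; 1; 2; 1; 2; 2; 0;
        0; 1; 2; 2; 1; 1; 1; 0; 1; 0; 2; 1; 1; 0; 2; 1; 0; 1; 2; 2; 1; 2; 2;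
        0; 1; 0; 2; 0; 2; 0; 2; 1; 0; 1; 2; 1; 0; 2; 2; 0; 1];
    [:: 0; 1; 2; 0; 0; 1; 2; 1; 2; 2; 0; 1; 1; 0; 1; 1; 0; 0; 1; 2; 2; 0; 2;
        0; 0; 1; 0; 0; 0; 0; 2; 1; 1; 0; 0; 1; 1; 0; 2; 2; 2; 0; 1; 2; 2; 1;
        2; 0; 1; 2; 0; 1; 0; 0; 1; 1; 2; 0; 1; 2; 1; 0; 2; 2];
    [:: 0; 1; 0; 2; 0; 0; 2; 2; 1; 0; 2; 1; 1; 0; 1; 1; 0; 2; 0; 0; 0; 0; 1;
        2; 1; 0; 0; 1; 2; 0; 1; 1; 0; 0; 2; 1; 1; 2; 1; 0; 2; 2; 0; 2; 0; 0;
        1; 1; 2; 0; 2; 1; 2; 0; 1; 1; 1; 0; 2; 0; 1; 2; 1; 1];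
    [:: 0; 2; 0; 1; 1; 0; 1; 0; 0; 2; 2; 0; 2; 2; 0; 1; 0; 1; 0; 1; 0; 2; 0;
        1; 1; 0; 1; 1; 1; 2; 1; 1; 2; 1; 2; 0; 2; 2; 0; 0; 1; 0; 0; 1; 0; 2;
        1; 1; 2; 2; 2; 0; 2; 2; 1; 0; 1; 2; 2; 0; 0; 2; 1; 1];
    [:: 1; 0; 1; 2; 1; 1; 0; 2; 0; 1; 0; 1; 0; 1; 2; 2; 1; 0; 2; 0; 1; 1; 2;
        2; 0; 1; 1; 2; 0; 1; 2; 2; 1; 0; 0; 0; 2; 0; 2; 2; 0; 1; 1; 2; 1; 0;
        2; 0; 2; 0; 1; 2; 2; 0; 2; 2; 0; 1; 0; 1; 0; 1; 2; 0];
    [:: 0; 0; 0; 0; 0; 0; 1; 0; 1; 0; 0; 2; 1; 0; 1; 2; 2; 1; 2; 2; 2; 2; 0;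
        0; 1; 2; 2; 1; 1; 2; 1; 1; 0; 1; 1; 1; 0; 0; 2; 2; 1; 0; 2; 1; 2; 1;
        2; 1; 0; 2; 0; 1; 0; 0; 1; 2; 1; 0; 1; 2; 2; 0; 1; 1];
    [:: 2; 0; 2; 1; 2; 0; 1; 0; 1; 2; 2; 0; 1; 2; 0; 1; 2; 2; 0; 1; 0; 2; 1;
        2; 1; 2; 2; 2; 1; 2; 0; 0; 0; 2; 0; 0; 0; 2; 1; 0; 1; 0; 1; 1; 1; 0;
        2; 1; 0; 1; 2; 0; 2; 1; 0; 0; 1; 2; 1; 0; 0; 2; 1; 1];
    [:: 0; 0; 1; 2; 2; 0; 1; 0; 1; 1; 2; 1; 0; 2; 0; 1; 2; 2; 0; 1; 1; 2; 1;
        2; 2; 0; 1; 2; 2; 2; 1; 0; 0; 2; 0; 0; 0; 2; 1; 1; 1; 0; 0; 0; 1; 0;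
        1; 2; 0; 1; 2; 0; 2; 2; 0; 0; 1; 2; 0; 1; 1; 2; 1; 1];
    [:: 2; 0; 0; 1; 2; 0; 1; 1; 1; 0; 1; 1; 0; 0; 1; 1; 1; 0; 2; 0; 2; 0; 1;
        2; 1; 2; 2; 1; 0; 0; 1; 2; 2; 0; 2; 2; 1; 0; 2; 2; 0; 2; 0; 2; 0; 0;
        1; 1; 2; 0; 1; 1; 1; 0; 2; 2; 0; 0; 0; 2; 0; 1; 2; 1];
    [:: 0; 1; 0; 1; 0; 1; 0; 2; 1; 0; 0; 0; 1; 1; 2; 1; 0; 1; 2; 1; 2; 0; 2;
        2; 1; 0; 0; 0; 1; 1; 2; 2; 0; 1; 0; 2; 2; 0; 2; 2; 1; 0; 1; 2; 1; 0;
        2; 2; 0; 1; 0; 2; 0; 1; 2; 2; 1; 0; 1; 2; 1; 0; 2; 1];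
    [:: 2; 1; 0; 0; 0; 1; 2; 2; 1; 1; 1; 2; 1; 0; 2; 0; 2; 1; 1; 0; 2; 1; 0;
        2; 0; 1; 0; 2; 0; 1; 2; 0; 2; 1; 1; 1; 1; 1; 0; 2; 0; 1; 0; 0; 0; 1;
        0; 0; 2; 0; 2; 2; 2; 1; 2; 2; 0; 2; 1; 0; 1; 1; 0; 0];
    [:: 0; 1; 0; 2; 0; 1; 0; 0; 1; 1; 1; 0; 1; 2; 0; 2; 0; 1; 1; 0; 0; 1; 0;
        0; 2; 1; 2; 0; 2; 1; 0; 2; 0; 1; 1; 1; 1; 1; 2; 0; 2; 1; 2; 2; 2; 1;
        0; 2; 0; 1; 0; 2; 0; 1; 0; 0; 2; 0; 1; 2; 1; 1; 2; 2];
    [:: 0; 1; 0; 0; 0; 1; 0; 0; 1; 1; 1; 0; 1; 1; 0; 2; 0; 1; 1; 0; 0; 1; 0;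
        0; 2; 1; 2; 0; 2; 1; 0; 2; 0; 1; 1; 2; 1; 1; 2; 0; 2; 1; 2; 2; 2; 1;
        0; 2; 0; 1; 0; 2; 0; 1; 2; 0; 2; 0; 1; 2; 1; 1; 2; 2];
    [:: 1; 2; 2; 0; 1; 1; 0; 1; 0; 2; 2; 1; 0; 2; 1; 0; 1; 2; 2; 1; 1; 2; 0;
        1; 0; 2; 0; 2; 0; 2; 1; 0; 1; 2; 1; 0; 2; 2; 0; 1; 0; 2; 0; 0; 0; 2;
        0; 0; 1; 0; 1; 0; 1; 2; 1; 1; 0; 1; 2; 1; 2; 2; 0; 0];
    [:: 2; 0; 2; 0; 1; 0; 1; 1; 0; 2; 2; 1; 0; 0; 1; 1; 1; 0; 2; 1; 1; 0; 1;
        1; 0; 2; 0; 2; 0; 2; 1; 0; 2; 0; 0; 1; 2; 0; 2; 1; 0; 2; 0; 2; 1; 0;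
        1; 1; 2; 0; 1; 0; 2; 2; 1; 1; 0; 2; 2; 1; 0; 0; 1; 1];
    [:: 2; 1; 1; 0; 0; 1; 0; 0; 1; 2; 1; 2; 0; 2; 0; 0; 2; 1; 1; 0; 2; 1; 0;
        0; 1; 2; 1; 0; 0; 2; 0; 0; 2; 1; 2; 1; 2; 1; 0; 0; 1; 2; 2; 0; 1; 1;
        0; 0; 2; 1; 2; 1; 0; 1; 0; 0; 1; 2; 2; 2; 1; 1; 0; 0];
    [:: 0; 1; 0; 1; 0; 0; 0; 0; 1; 2; 1; 1; 1; 1; 0; 1; 0; 1; 1; 2; 0; 1; 0;
        0; 1; 0; 1; 2; 2; 2; 1; 1; 0; 2; 2; 2; 0; 2; 0; 0; 1; 0; 2; 0; 1; 2;
        1; 1; 0; 1; 2; 1; 0; 0; 2; 0; 1; 0; 2; 0; 1; 1; 2; 2];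
    [:: 1; 0; 2; 1; 2; 0; 1; 1; 0; 2; 0; 0; 0; 0; 1; 2; 1; 0; 0; 2; 2; 0; 1;
        1; 0; 0; 2; 1; 1; 0; 1; 0; 2; 2; 0; 2; 0; 0; 1; 2; 2; 1; 2; 1; 2; 2;
        0; 1; 1; 0; 2; 1; 1; 2; 1; 1; 0; 1; 1; 2; 0; 0; 2; 2];
    [:: 1; 0; 1; 2; 1; 0; 1; 1; 0; 2; 0; 0; 0; 0; 1; 0; 1; 0; 0; 2; 1; 0; 1;
        2; 0; 1; 2; 2; 2; 2; 0; 0; 1; 2; 2; 1; 1; 2; 1; 1; 0; 1; 1; 1; 0; 0;
        2; 0; 1; 0; 2; 0; 2; 1; 2; 1; 0; 2; 0; 1; 0; 0; 1; 2];
    [:: 1; 0; 0; 1; 1; 0; 1; 1; 0; 0; 1; 2; 2; 0; 1; 0; 1; 0; 2; 0; 0; 2; 1;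
        1; 2; 2; 0; 2; 1; 0; 1; 2; 2; 0; 2; 2; 2; 2; 1; 1; 0; 2; 0; 1; 0; 0;
        1; 1; 1; 0; 0; 2; 1; 0; 1; 2; 0; 1; 2; 1; 2; 2; 0; 0]].

Definition proper_on (k : nat) (c : seq nat) (e : nat * nat) : bool :=
  all (ltn^~ k) c &&
  all (fun u => let r := nb u in let cu := nth 0 c u in
    all (fun v => if cu == nth 0 c v
                  then ((u, v) == e) || ((v, u) == e) else true) r)
  (iota 0 64).

Lemma edge_colorings_proper :
  all2 (fun p c => proper_on 3 c (p.1, (p.1 + p.2) %% 64))
    G64_pairs edge_colorings.
Proof. by vm_compute. Qed.

Lemma proper_on_colorable c p :
  proper_on 3 c (p.1, (p.1 + p.2) %% 64) -> p.1 < 64 ->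
  colorable (del_edges [set base_edge p]) 3.
Proof.
case/andP=> /all_nthP c3 cP p64.
have {}c3 n : nth 0 c n < 3.
  by have [nc|nc] := ltnP n (size c); [apply: c3 | rewrite nth_default].
apply/existsP; exists [ffun v : G64 => inord (nth 0 c (val v))].
apply/forallP=> u; apply/forallP=> v; apply/implyP=> /andP[].
rewrite adjE inE => uv ne; rewrite !ffunE -(inj_eq val_inj) /= !inordK //.
have /allP/(_ _ uv) := all_vertices u cP; case: ifP => // _ ends.
apply: contra ne => _; rewrite /base_edge eq_set2 -!(inj_eq val_inj).
move: ends; rewrite !xpair_eqE vtxK // => ends.
by rewrite val_vtx [(val u == _ %% 64) && _]andbC.
Qed.

Lemma edge_deleted_3_colorable e :
  e \in edges G64 -> colorable (del_edges [set e]) 3.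
Proof.
case/edge_rot=> p [k [pP ->]].
apply: colorable_del_edge_aut; first exact: rot8X_aut.
have := edge_colorings_proper; rewrite all2E => /andP[_ /allP proper].
pose i := index p G64_pairs.
have ip : i < 20 by rewrite -[20]/(size G64_pairs) index_mem.
apply: (@proper_on_colorable (nth [::] edge_colorings i)); last first.
  exact: pairs_lt64.
have := proper (p, nth [::] edge_colorings i); apply.
rewrite -{1}(nth_index (0, 0) pP) -nth_zip //.
by apply: mem_nth; rewrite size_zip.
Qed.

Lemma vertex_deleted_3_colorable (v : G64) : colorable (del_vertices [set v]) 3.
Proof.
have /card_gt0P[w] : 0 < degree v by apply: leq_trans (degree_ge4 v).
rewrite inE => vw; apply: (colorable_del_vertex vw).
by apply: edge_deleted_3_colorable; apply: edge_in_edges.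
Qed.

(** * Orbits of the automorphism group *)

Lemma rot8X_inj i j (v : G64) : i < 8 -> j < 8 ->
  (rot8 ^+ i)%g v = (rot8 ^+ j)%g v -> i = j.
Proof.
move=> i8 j8 /(congr1 val)/eqP; rewrite !val_rot8X eqn_modDl.
have lt64 k : k < 8 -> 8 * k < 64 by rewrite -[64]/(8 * 8) ltn_pmul2l.
by rewrite !modn_small ?lt64 // eqn_pmul2l // => /eqP.
Qed.

Lemma card_porbit_rot8 (v : G64) : #|porbit rot8 v| = 8.
Proof.
rewrite porbit.unlock card_in_imset; first by rewrite -orderE order_rot8.
move=> s t /cyclePmin[i i8 ->] /cyclePmin[j j8 ->].
rewrite !order_rot8 in i8 j8.
by rewrite /aperm => /(rot8X_inj i8 j8)->.
Qed.

Lemma card_vertex_orbits : #|vertex_orbits G64| = 8.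
Proof.
have part : partition (vertex_orbits G64) [set: G64].
  by apply: orbit_partition; apply/actsP=> s _ v; rewrite !inE.
have := card_uniform_partition _ part => /(_ 8).
rewrite cardsT card_G64 => H.
apply/eqP; rewrite -(eqn_pmul2r (m := 8)) // -H //.
by move=> O /imsetP[v _ ->]; rewrite graph_autE -porbitE card_porbit_rot8.
Qed.

Lemma setact_rot8X k p :
  ('P^*)%act (base_edge p) (rot8 ^+ k)%g = rot_edge k p.
Proof. by rewrite /= /setact /base_edge imsetU !imset_set1. Qed.

Lemma base_edge_orbit e p : reflect (exists2 k, k < 8 & e = rot_edge k p)
  (e \in orbit ('P^*)%act (graph_aut G64) (base_edge p)).
Proof.
rewrite graph_autE; apply: (iffP orbitP) => [[s /cyclePmin[k k8 ->]]|[k k8 ->]].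
  by rewrite setact_rot8X => <-; exists k; rewrite -?order_rot8.
by exists (rot8 ^+ k)%g; rewrite ?mem_cycle ?setact_rot8X.
Qed.

(** An equality of unordered pairs, hence the two alternatives. *)
Definition same_rotated (p q : nat * nat) (k : nat) : bool :=
  let a := p.1 in let b := (p.1 + p.2) %% 64 in
  let c := (q.1 + 8 * k) %% 64 in let d := (q.1 + q.2 + 8 * k) %% 64 in
  (a == c) && (b == d) || (a == d) && (b == c).

Lemma rot_edge_eq p q k :
  p.1 < 64 -> base_edge p = rot_edge k q -> same_rotated p q k.
Proof.
move=> p64 /eqP; rewrite eq_set2 -!(inj_eq val_inj) !val_rot8X !val_vtx.
by rewrite !modnDml modn_small.
Qed.

(** This keeps the orbits of the twenty base edges apart. *)
Lemma pairs_distinct : all (fun p => all (fun q => all (fun k =>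
  same_rotated p q k ==> (p == q)) (iota 0 8)) G64_pairs) G64_pairs.
Proof. by vm_compute. Qed.

Lemma card_edge_orbits : #|edge_orbits G64| = 20.
Proof.
pose orb p := orbit ('P^*)%act (graph_aut G64) (base_edge p).
have orb_inj : {in G64_pairs &, injective orb}.
  move=> p q pP qP E; have /base_edge_orbit[k k8] : base_edge p \in orb q.
    by rewrite -E orbit_refl.
  move/(rot_edge_eq (pairs_lt64 pP)) => same; apply/eqP.
  have /allP/(_ q qP)/allP/(_ k) := allP pairs_distinct p pP.
  by rewrite mem_iota same; apply.
have -> : edge_orbits G64 = [set:: map orb G64_pairs].
  apply/setP=> O; rewrite inE; apply/imsetP/mapP => [[e eE ->]|[p pP ->]].
    have [p [k [pP ek]]] := edge_rot eE; exists p => //.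
    apply/orbit_eqP; rewrite ek -setact_rot8X; exact: mem_orbit (rot8X_aut k).
  exists (base_edge p) => //; apply: edge_in_edges.
  apply/orP; left; apply/hasP; exists p => //.
  rewrite /vtx natrD eqxx andbT -[nat_of_ord _]/(val (vtx p.1)).
  by rewrite vtxK ?pairs_lt64.
rewrite cardsE; have /card_uniqP-> : uniq (map orb G64_pairs).
  by rewrite map_inj_in_uniq.
by rewrite size_map.
Qed.

Theorem proposition3 :
  [/\ k_connected G64 4,
      [/\ vertex_connectivity G64 = 4,
          edge_connectivity G64 = 4 &
          min_degree G64 = 4],
      #|G64| = 64 /\ #|edges G64| = 152 &
      #|[set v : G64 | degree v == 5]| = 48 /\
      #|[set v : G64 | degree v == 4]| = 16]
  /\
  (* (i) *)
  [/\ (forall s : seq G64, is_cycle s -> size s \notin [:: 3; 4; 5]),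
      @is_cycle G64 ([:: 0; 40; 36; 44; 34; 15]%R : seq 'Z_64) &
      girth G64 = Some 6]
  /\
  (* (ii) *)
  [/\ proper_coloring c64,
      ~~ colorable G64 3 &
      chromatic_number G64 = 4]
  /\
  (* (iii) *)
  [/\ vertex_critical G64,
      edge_critical G64,
      (forall v : G64, colorable (del_vertices [set v]) 3) &
      (forall e, e \in edges G64 -> colorable (del_edges [set e]) 3)]
  /\
  (* (iv) *)
  independence_number G64 = 24
  /\
  (* (v) *)
  [/\ [/\ cyclic (graph_aut G64),
          #|graph_aut G64| = 8,
          graph_aut G64 = <[rot8]>%g &
          semiregular_perm rot8],
      #|vertex_orbits G64| = 8 &
      #|edge_orbits G64| = 20].
Proof.
split; last split; last split; last split; last split.
- split; last by rewrite !card_degree.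
  + exact: G64_4_connected.
  + split; first exact: vertex_connectivityE G64_4_connected degree2.
      exact: edge_connectivityE (k_connected_edge _ G64_4_connected) degree2.
    exact: min_degreeE degree_ge4 degree2.
  + by rewrite card_G64 card_edges_G64.
- split; [|exact: cycle6|exact: girth_G64].
  by move=> s /cycle_size; case: (size s) => [|[|[|[|[|[|]]]]]].
- split; [exact: G64_4_coloring|exact: G64_not_3_colorable|].
  exact: chromatic_number_G64.
- split.
  + by move=> v; rewrite chromatic_number_G64 ltnS chromatic_number_leq
                         vertex_deleted_3_colorable.
  + move=> e eE; rewrite chromatic_number_G64 ltnS chromatic_number_leq.
    exact: edge_deleted_3_colorable.
  + exact: vertex_deleted_3_colorable.
  + exact: edge_deleted_3_colorable.
- exact: independence_number_G64.
- split; [|exact: card_vertex_orbits|exact: card_edge_orbits].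
  rewrite graph_autE cycle_cyclic -orderE order_rot8.
  by split=> // u v; rewrite !card_porbit_rot8.
Qed.
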